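(* There exist an ergodic measure-preserving $\mathbb{Z}^2$ dynamical system $(\Omega,\mathcal{F},\mathbb{P},\{T^z\}_{z\in\mathbb{Z}^2})$ and a measurable stationary arrow map $\alpha:\Omega\times\mathbb{Z}^2\to\{e_1,e_2\}$, for which almost surely all the walks $X_z$, $z\in\mathbb{Z}^2$, coalesce and no walk has an asymptotic direction, such that the following holds. Assign to the edge $\{x,x+z\}$, $x\in\mathbb{Z}^2$, $z\in\{e_1,e_2\}$, the weight $w_z(T^x\omega)$, where $$w_z(\omega)=\begin{cases}\tfrac12 & \text{if }\alpha(\omega,\mathbf{0})=z,\\ 1&\text{otherwise.}\end{cases}$$ This is a first-passage percolation model with stationary edge weights on $\mathbb{Z}^2$ for which the walks $\{X_z\}$ form a family of compatible geodesics that coalesce almost surely, and with probability $1$ a positive density of points $z\in\mathbb{Z}^2$ have geodesics $X_z$ with no asymptotic direction.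
   Context: The arrow map is stationary if $\alpha(\omega,z)=\alpha(T^z\omega,\mathbf{0})$ for all $z$ almost surely. The walks are $X_z(\omega,0)=z$, $X_z(\omega,k+1)=X_z(\omega,k)+\alpha(\omega,X_z(\omega,k))$. Two walks coalesce if they share a vertex; the family is compatible if $X_z(\omega,k+1)=X_{X_z(\omega,1)}(\omega,k)$. In first-passage percolation with edge weights, the passage time $T(x,y)$ is the infimum over nearest-neighbor paths from $x$ to $y$ of the sum of the weights of its edges; a semi-infinite path is a geodesic if for any two of its vertices the segment of the path between them attains the passage time between them. A walk $X$ has an asymptotic direction if $X(k)/|X(k)|$ converges as $k\to\infty$. A set $A\subset\mathbb{Z}^2$ has density $c$ if $|A\cap[-N,N]^2|/(2N+1)^2\to c$. *)

(* Defs.v *)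
From HB Require Import structures.
From mathcomp Require Import all_boot all_order all_algebra finmap.
From mathcomp Require Import all_classical all_reals all_analysis.

Set Implicit Arguments.
Unset Strict Implicit.
Unset Printing Implicit Defensive.

Import Order.TTheory GRing.Theory Num.Theory.
Import numFieldNormedType.Exports.

Local Open Scope classical_set_scope.
Local Open Scope ring_scope.

Notation Z2 := (int * int)%type.

(* The set of steps {e_1, e_2} is encoded by [bool], so that it carries the
   library's finite type and discrete sigma-algebra; [vec] recovers the vector. *)
Notation step := bool.
Notation e1 := false.
Notation e2 := true.

Definition vec (z : step) : Z2 := if z is e1 then (1, 0) else (0, 1).

(* All subsets of [int] are measurable; the product sigma-algebra on [Z2] is
   then also the full power set. *)
HB.instance Definition _ := isPointed.Build int 0.
HB.instance Definition _ := @isMeasurable.Build default_measure_display int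
  (@discrete_measurable int) (@discrete_measurable0 int)
  (@discrete_measurableC int) (@discrete_measurableU int).

Section DynamicalSystem.
Context {R : realType} {d : measure_display} {Omega : measurableType d}.
Variables (P : probability Omega R) (tau : Z2 -> Omega -> Omega).

Definition Z2_action : Prop :=
  (forall omega, tau 0 omega = omega) /\
  (forall x y omega, tau (x + y) omega = tau x (tau y omega)).

Definition measure_preserving : Prop :=
  forall z, measurable_fun [set: Omega] (tau z) /\
    forall A, measurable A -> P (tau z @^-1` A) = P A.

Definition ergodic : Prop :=
  forall A, measurable A -> (forall z, tau z @^-1` A = A) ->
    P A = 0%E \/ P A = 1%E.

Definition ergodic_mp_system : Prop :=
  [/\ Z2_action, measure_preserving & ergodic].

Variable alpha : Omega * Z2 -> step.

Definition stationary_arrows : Prop :=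
  {ae P, forall omega, forall z, alpha (omega, z) = alpha (tau z omega, 0)}.

Fixpoint walk (omega : Omega) (z : Z2) (k : nat) : Z2 :=
  if k is k'.+1 then
    walk omega z k' + vec (alpha (omega, walk omega z k'))
  else z.

Definition step_weight (z : step) (omega : Omega) : R :=
  if alpha (omega, 0) == z then 2^-1 else 1.

Definition arrow_weights (omega : Omega) (x : Z2) (z : step) : R :=
  step_weight z (tau x omega).

End DynamicalSystem.

Section Walks.

Definition coalesce (X Y : nat -> Z2) : Prop := exists k l, X k = Y l.

Definition compatible (X : Z2 -> nat -> Z2) : Prop :=
  forall z k, X z k.+1 = X (X z 1%N) k.

Definition euclidean_norm {R : realType} (v : Z2) : R :=
  Num.sqrt (v.1%:~R ^+ 2 + v.2%:~R ^+ 2).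

Definition direction {R : realType} (v : Z2) : R * R :=
  (v.1%:~R / euclidean_norm v, v.2%:~R / euclidean_norm v).

Definition has_asymptotic_direction (R : realType) (X : nat -> Z2) : Prop :=
  exists u : R * R, direction (X k) @[k --> \oo] --> u.

Definition box (N : nat) : set Z2 :=
  [set z | `|z.1| <= N%:Z /\ `|z.2| <= N%:Z].

Definition has_density {R : realType} (A : set Z2) (c : R) : Prop :=
  (#|` fset_set (A `&` box N)|%fset)%:R / (N.*2.+1 ^ 2)%:R @[N --> \oo] --> c.

End Walks.

(* Edge weights are functions [W : Z2 -> step -> R], where [W x z] is the weight
   of the undirected edge {x, x + vec z}; every edge of Z^2 is represented by
   exactly one pair (x, z). *)
Section FirstPassagePercolation.
Context {R : realType}.
Implicit Types (W : Z2 -> step -> R) (u v x y : Z2) (p : seq Z2).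

Definition neighbors : rel Z2 :=
  fun u v => [exists z : step, (v == u + vec z) || (u == v + vec z)].

(* Only meaningful when [u] and [v] are neighbors. *)
Definition edge_weight W u v : R :=
  if v == u + vec e1 then W u e1
  else if v == u + vec e2 then W u e2
  else if u == v + vec e1 then W v e1
  else W v e2.

(* [x :: p] is the list of vertices of a path started at [x]. *)
Definition path_weight W x p : R :=
  \sum_(e <- zip (x :: p) p) edge_weight W e.1 e.2.

Definition passage_time W x y : \bar R :=
  ereal_inf [set (path_weight W x p)%:E | p in
    [set p | path neighbors x p /\ last x p = y]].

Definition geodesic W (X : nat -> Z2) : Prop :=
  (forall k, neighbors (X k) (X k.+1)) /\
  (forall m n, (m <= n)%N ->
    (path_weight W (X m) [seq X i | i <- index_iota m.+1 n.+1])%:E =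
    passage_time W (X m) (X n)).

Definition shift_weights y W : Z2 -> step -> R := fun x z => W (x + y) z.

Definition cylinders : set (set (Z2 -> step -> R)) :=
  [set A | exists x z (B : set (measurableTypeR R)), measurable B /\
    A = [set W | B (W x z)]].

Context {d : measure_display} {Omega : measurableType d}.

(* Stationarity: the law of the whole weight field, a measure on the product
   sigma-algebra <<s cylinders>>, is invariant under translations of Z^2. *)
Definition stationary_fpp (P : probability Omega R)
    (W : Omega -> Z2 -> step -> R) : Prop :=
  [/\ forall omega x z, 0 <= W omega x z,
      forall x z, measurable_fun [set: Omega]
        (fun omega => W omega x z : measurableTypeR R) &
      forall y A, <<s cylinders >> A ->
        P [set omega | A (shift_weights y (W omega))] =
        P [set omega | A (W omega)]].

End FirstPassagePercolation.

(* Main.v *)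
From HB Require Import structures.
Require Import Defs.
From mathcomp Require Import finmap all_boot all_order all_algebra.
From mathcomp Require Import all_classical all_reals all_analysis.
From mathcomp Require Import zify lra.

Import Order.TTheory GRing.Theory Num.Theory.
Import numFieldNormedType.Exports.

Local Open Scope classical_set_scope.
Local Open Scope ring_scope.

(* The system is the odometer: Z^2 acts by translation on pairs of 2-adic
   integers, so omega places on Z^2 nested families of vertical lines with
   spacing 2^(a n) and horizontal lines with spacing 2^(b n), n = 0, 1, ...
   At a point, go up exactly when every level whose horizontal line passes
   through the point also has its vertical line there.  A walk that meets a
   level-n line then follows it up to the next crossing of two level-n lines:
   all walks started in a level-n cell leave it through its upper right corner.
   Almost surely two given points lie in a common cell of some level, hence
   coalescence.  The exponents a and b alternate (a n = n^2 and b n = (n-1)^2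
   for odd n, and conversely for even n); by Borel-Cantelli the corner of the
   level-n cell is seen from the starting point almost horizontally for n odd
   and almost vertically for n even, so there is no asymptotic direction.
   Finally every edge weighs at least 1/2, and a walk is a shortest lattice
   path with all weights 1/2, hence a geodesic. *)

(** * Directed walks are geodesics *)

Section Walks.
Context {d : measure_display} {Omega : measurableType d}.
Variables (tau : Z2 -> Omega -> Omega) (alpha : Omega * Z2 -> step).

Lemma compatible_walk w : compatible (walk alpha w).
Proof. by move=> z; elim=> [//|k /= <-]. Qed.

Lemma walk_l1 w z k :
  (walk alpha w z k).1 + (walk alpha w z k).2 = z.1 + z.2 + k%:Z.
Proof.
elim: k => [|k IH] /=; first by rewrite addr0.
by case: (alpha _) => /=; lia.
Qed.

Variable R : realType.

Lemma path_weight_cons (W : Z2 -> step -> R) x y p :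
  path_weight W x (y :: p) = edge_weight W x y + path_weight W y p.
Proof. by rewrite /path_weight /= big_cons. Qed.

Lemma path_weight_ge (W : Z2 -> step -> R) x p :
  (forall y z, 2^-1 <= W y z) -> (size p)%:R / 2 <= path_weight W x p.
Proof.
move=> Wge; elim: p x => [|y p IH] x;
  first by rewrite /path_weight /= big_nil mul0r.
rewrite path_weight_cons /= -[X in X / _ <= _]natr1 mulrDl mul1r addrC lerD //.
by rewrite /edge_weight; do 3?case: ifP => _.
Qed.

(** A step changes the coordinate sum by at most one, so a path needs at least as many edges as the
    sum increases. *)
Lemma path_size_l1 x p : path neighbors x p ->
  (last x p).1 + (last x p).2 <= x.1 + x.2 + (size p)%:Z.
Proof.
elim: p x => [|y p IH] x /=; first by rewrite addr0.
move=> /andP[/existsP[z xy] /IH]; suff: y.1 + y.2 <= x.1 + x.2 + 1 by lia.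
by case/orP: xy => /eqP ->; case: z => /=; lia.
Qed.

Lemma edge_weight_vec (W : Z2 -> step -> R) x z :
  edge_weight W x (x + vec z) = W x z.
Proof.
rewrite /edge_weight; case: z; last by rewrite eqxx.
by rewrite eqxx ifF //; apply/negbTE/eqP => /addrI.
Qed.

Hypothesis alpha_tau : forall w z, alpha (w, z) = alpha (tau z w, 0).

Lemma arrow_weights_ge w x z : 2^-1 <= arrow_weights tau alpha w x z :> R.
Proof. by rewrite /arrow_weights /step_weight; case: ifP => // _; lra. Qed.

Lemma path_weight_walk w z m k :
  path_weight (arrow_weights tau alpha w) (walk alpha w z m)
    [seq walk alpha w z i | i <- iota m.+1 k] = k%:R / 2 :> R.
Proof.
elim: k m => [|k IH] m; first by rewrite /path_weight /= big_nil mul0r.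
rewrite [iota _ _]/= map_cons path_weight_cons IH edge_weight_vec.
rewrite /arrow_weights /step_weight -alpha_tau eqxx -[X in _ = X / _]natr1.
by rewrite mulrDl mul1r addrC.
Qed.

Lemma geodesic_walk w z :
  geodesic (arrow_weights tau alpha w : Z2 -> step -> R) (walk alpha w z).
Proof.
have nb k : neighbors (walk alpha w z k) (walk alpha w z k.+1).
  by apply/existsP; eexists; apply/orP; left; apply/eqP.
split=> // m n mn; rewrite /index_iota subSS path_weight_walk.
apply/eqP; rewrite eq_le; apply/andP; split; last first.
  apply: ereal_inf_lbound; exists [seq walk alpha w z i | i <- iota m.+1 (n - m)].
    have [k ->] : exists k, n = (m + k)%N by exists (n - m)%N; rewrite subnKC.
    rewrite addKn; split; first by elim: k m {mn} => //= k IH m; rewrite nb;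
      exact: IH.
    rewrite last_map; congr walk.
    by elim: k m {mn} => /= [m|k IH m]; rewrite ?addn0 // IH addSnnS.
  by rewrite path_weight_walk.
(* Along the walk the coordinate sum grows by exactly [n - m]; any competitor thus has at least
   [n - m] edges, each of weight at least 1/2. *)
apply: le_ereal_inf_tmp => _ [p [pp pl] <-]; rewrite lee_fin.
apply: le_trans (path_weight_ge _ _ _ (arrow_weights_ge w)).
rewrite ler_pM2r ?invr_gt0 // ler_nat.
have := path_size_l1 _ _ pp; rewrite pl !walk_l1; lia.
Qed.

End Walks.

(** * The odometer and the corners of its cells *)

(* Digits are arbitrary integers and no carry is ever performed: [decr] changes
   digit 0 only, and the sigma-algebra sees an odometer only through residues,
   that is, modulo the carries.  [residue w.1 n] is the distance from the origin
   rightwards to the next vertical line of the family with spacing 2^n. *)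
Definition residue (a : nat -> int) n : int :=
  ((\sum_(i < n) a i * 2 ^+ i) %% 2 ^+ n)%Z.

Definition decr (c : int) (a : nat -> int) : nat -> int :=
  fun i => a i - c *+ (i == 0%N).

Definition cylinder n (c : Z2) : set ((nat -> int) * (nat -> int)) :=
  [set w | residue w.1 n = (c.1 %% 2 ^+ n)%Z /\ residue w.2 n = (c.2 %% 2 ^+ n)%Z].

(** The empty set is included to make the family closed under intersection. *)
Definition odo_cylinders : set (set ((nat -> int) * (nat -> int))) :=
  [set A | A = set0 \/ exists n c, A = cylinder n c].

Notation odometer := (g_sigma_algebraType odo_cylinders).

Definition otau (z : Z2) (w : odometer) : odometer :=
  (decr z.1 w.1, decr z.2 w.2).

Lemma expz2_gt0 n : 0 < 2 ^+ n :> int. Proof. exact: exprn_gt0. Qed.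

Lemma expz2E n : 2 ^+ n = (2 ^ n)%N%:Z.
Proof. by rewrite -natz natrX. Qed.

Lemma residue_ge0 a n : 0 <= residue a n.
Proof. by rewrite modz_ge0 // gt_eqF // expz2_gt0. Qed.

Lemma residue_lt a n : residue a n < 2 ^+ n.
Proof. by rewrite ltz_pmod // expz2_gt0. Qed.

Lemma decr0 a : decr 0 a = a.
Proof. by apply/funext => i; rewrite /decr mul0rn subr0. Qed.

Lemma decrD b c a : decr (b + c) a = decr b (decr c a).
Proof. by apply/funext => i; rewrite /decr mulrnDl opprD addrA addrAC. Qed.

Lemma otau0 w : otau 0 w = w.
Proof. by case: w => a b; rewrite /otau !decr0. Qed.

Lemma otauD x y w : otau (x + y) w = otau x (otau y w).
Proof. by rewrite /otau [(x + y).1]/= [(x + y).2]/= !decrD. Qed.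

Lemma residue_decr c a n : residue (decr c a) n = ((residue a n - c) %% 2 ^+ n)%Z.
Proof.
case: n => [|n]; first by rewrite /residue !expr0 !modz1.
rewrite /residue modzDml; congr (_ %% _)%Z.
rewrite !big_ord_recl /decr /= mulr1n mulrBl expr0 !mulr1 addrAC;
  congr (_ + _ - _).
by apply: eq_bigr => i _; rewrite subr0.
Qed.

Lemma residue_decr_small c a n : 0 <= c <= residue a n ->
  residue (decr c a) n = residue a n - c.
Proof.
by move=> /andP[c0 cr]; rewrite residue_decr modz_small //;
  have := residue_lt a n; lia.
Qed.

Lemma modz_exp2 (x : int) m n : (m <= n)%N ->
  ((x %% 2 ^+ n)%Z %% 2 ^+ m)%Z = (x %% 2 ^+ m)%Z.
Proof.
move=> /subnKC <-.
rewrite {2}(divz_eq x (2 ^+ (m + (n - m)))) exprD [2 ^+ m * _]mulrC mulrA.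
by rewrite modzMDl.
Qed.

Lemma residue_mod a m n : (m <= n)%N -> (residue a n %% 2 ^+ m)%Z = residue a m.
Proof.
move=> mn; rewrite /residue modz_exp2 //; move/subnKC: mn => <-.
elim: (n - m)%N => [|k IH]; first by rewrite addn0.
rewrite -{}IH addnS big_ord_recr /=; set S := \sum_(_ < _) _.
by rewrite addrC exprD [2 ^+ m * _]mulrC mulrA modzMDl.
Qed.

Lemma residue_eq0 a m n : (m <= n)%N -> residue a n = 0 -> residue a m = 0.
Proof. by move=> mn an; rewrite -(residue_mod _ _ _ mn) an mod0z. Qed.

(* [scale true] is the exponent a of the vertical lines, [scale false] the
   exponent b of the horizontal ones. *)
Definition scale (b : bool) n : nat :=
  if odd n == b then (n ^ 2)%N else (n.-1 ^ 2)%N.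

(** For m < n the square m^2 separates the two values, since [scale b m] is at most m^2 and
    [scale b n] at least (n-1)^2. *)
Lemma leq_scale b m n : (m <= n)%N -> (scale b m <= scale b n)%N.
Proof.
move=> mn; have [->//|neq] := eqVneq m n.
by apply: (@leq_trans (m ^ 2)%N); rewrite /scale; case: ifP => _;
  rewrite leq_sqr; lia.
Qed.

Definition hdist (w : odometer) n : int := residue w.1 (scale true n).
Definition vdist (w : odometer) n : int := residue w.2 (scale false n).

(** Since [e2] is [true], the truth value of the rule for going up is itself the step. *)
Definition arrow0 (w : odometer) : step :=
  `[< forall n, vdist w n = 0 -> hdist w n = 0 >].

Definition arrow (p : odometer * Z2) : step := arrow0 (otau p.2 p.1).

Lemma hdist_decr w (z : Z2) n : 0 <= z.1 <= hdist w n ->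
  hdist (otau z w) n = hdist w n - z.1.
Proof. exact: residue_decr_small. Qed.

Lemma vdist_decr w (z : Z2) n : 0 <= z.2 <= vdist w n ->
  vdist (otau z w) n = vdist w n - z.2.
Proof. exact: residue_decr_small. Qed.

(** A step right comes from a level m whose horizontal line is present and whose vertical line is
    absent. Lines of a higher level are also lines of every lower one, so a vertical line of level n
    forces n < m, and then the horizontal line of level m is also one of level n. *)
Lemma arrow0_e1 w n : arrow0 w = e1 -> hdist w n = 0 -> vdist w n = 0.
Proof.
move=> /asboolPn/existsNP[m /not_implyP[vm hm]] hn.
have [mn|/ltnW nm] := leqP m n; first by case: hm; apply: residue_eq0 hn;
  exact: leq_scale.
by apply: residue_eq0 vm; exact: leq_scale.
Qed.

Lemma arrow0_e2 w n : arrow0 w = e2 -> vdist w n = 0 -> hdist w n = 0.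
Proof. by move=> /asboolP; apply. Qed.

(** Induction on the l1 distance to the corner. Off the corner, [arrow0_e1] and [arrow0_e2] forbid
    crossing a level-n line: a step right needs positive [hdist] and a step up positive [vdist], so
    each step lowers one distance by one and keeps the other. *)
Lemma walk_corner n (w : odometer) z :
  walk arrow w z (`|hdist (otau z w) n| + `|vdist (otau z w) n|)%N =
  z + (hdist (otau z w) n, vdist (otau z w) n).
Proof.
move En : (_ + _)%N => k; elim: k z En => [|k IH] z.
  have := residue_ge0 (otau z w).1 (scale true n).
  have := residue_ge0 (otau z w).2 (scale false n).
  rewrite -/(hdist _ _) -/(vdist _ _) => v0 h0 hv0.
  have [-> ->] : hdist (otau z w) n = 0 /\ vdist (otau z w) n = 0 by lia.
  by rewrite addr0.
have := residue_ge0 (otau z w).1 (scale true n).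
have := residue_ge0 (otau z w).2 (scale false n).
rewrite -/(hdist _ _) -/(vdist _ _) => v0 h0 hv.
rewrite compatible_walk [walk _ _ _ 1]/= -/(arrow0 (otau z w)).
move Es : (arrow (w, z)) => s.
have tauE : otau (z + vec s) w = otau (vec s) (otau z w) by rewrite addrC otauD.
move: (arrow0_e1 (otau z w) n) (arrow0_e2 (otau z w) n) (IH (z + vec s)).
have {Es} : arrow0 (otau z w) = s by [].
rewrite {}tauE; move: (otau z w) v0 h0 hv => w' v0 h0 hv; case: s => Es a1 a2.
- have {}a2 := a2 Es; rewrite hdist_decr ?vdist_decr /=; [|lia..].
  rewrite subr0 => -> //; last by lia.
  by apply: injective_projections => /=; lia.
- have {}a1 := a1 Es; rewrite hdist_decr ?vdist_decr /=; [|lia..].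
  rewrite subr0 => -> //; last by lia.
  by apply: injective_projections => /=; lia.
Qed.

(** * Typical odometers and coalescence *)

Definition typical (w : odometer) :=
  \forall n \near \oo, 2 ^+ scale true n <= hdist w n * 2 ^+ n /\
                       2 ^+ scale false n <= vdist w n * 2 ^+ n.

Lemma scale_ge b n : (3 < n)%N -> (n.*2 <= scale b n)%N.
Proof. by rewrite /scale; case: ifP => _ n3; nia. Qed.

Lemma typical_large w (D : int) : typical w ->
  \forall n \near \oo, D <= hdist w n /\ D <= vdist w n.
Proof.
move=> [N _ HN]; near=> n.
have [//|h v] := HN n; first by near: n; exact: nbhs_infty_ge.
have n3 : (3 < n)%N by near: n; exact: nbhs_infty_gt.
have nD : D <= 2 ^+ n.
  apply: (@le_trans _ _ n%:Z); last by rewrite expz2E lez_nat ltnW // ltn_expl.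
  suff : (`|D| <= n)%N by lia.
  by near: n; exact: nbhs_infty_ge.
have big b : 2 ^+ n * 2 ^+ n <= 2 ^+ scale b n :> int.
  by rewrite -exprD addnn ler_eXn2l ?scale_ge.
have := expz2_gt0 n; have := big true; have := big false.
by split; apply: le_trans nD _; rewrite -(ler_pM2r (expz2_gt0 n)); lia.
Unshelve. all: by end_near. Qed.

Lemma typical_ratio w b : typical w ->
  \forall n \near \oo, odd n = b ->
    if b then 2 * vdist w n <= hdist w n else 2 * hdist w n <= vdist w n.
Proof.
move=> [N _ HN]; near=> n => nb.
have [//|h v] := HN n; first by near: n; exact: nbhs_infty_ge.
have n1 : (1 < n)%N by near: n; exact: nbhs_infty_gt.
have := residue_lt w.1 (scale true n); have := residue_lt w.2 (scale false n).
rewrite -/(hdist _ _) -/(vdist _ _) => vlt hlt.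
(* The short side is 2^((n-1)^2), while the long distance is at least 2^(n^2-n), where n^2 - n =
   (n-1)^2 + (n-1); the surplus factor 2^(n-1) is at least 2. *)
have key (x y : int) : x < 2 ^+ (n.-1 ^ 2) -> 2 ^+ (n ^ 2) <= y * 2 ^+ n -> 2 * x <= y.
  have -> : (n ^ 2 = (n.-1 ^ 2 + n.-2).+1 + n)%N.
    by move: n1; clear; case: n => [|[|m]] //= _; nia.
  rewrite exprD ler_pM2r ?expz2_gt0 // exprS exprD => xlt.
  have := expz2_gt0 n.-2; have := expz2_gt0 (n.-1 ^ 2); nia.
by case: b nb => nb; move: h v vlt hlt; rewrite /scale nb /= => h v vlt hlt;
  apply: key.
Unshelve. all: by end_near. Qed.

Lemma otau_sub x y w : otau x w = otau (x - y) (otau y w).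
Proof. by rewrite -otauD subrK. Qed.

Lemma coalesce_walks w : (forall z, typical (otau z w)) ->
  forall x y, coalesce (walk arrow w x) (walk arrow w y).
Proof.
move=> tw x y.
have [z [zx1 zy1 zx2 zy2]] :
    exists z : Z2, [/\ z.1 <= x.1, z.1 <= y.1, z.2 <= x.2 & z.2 <= y.2].
  by exists (Order.min x.1 y.1, Order.min x.2 y.2); split=> /=; lia.
(* [D] dominates all four coordinate differences, so [x] and [y] lie in the same level-n cell as [z]
   once the corner is at distance [D] from [z] in both directions. *)
pose D : int := x.1 - z.1 + (y.1 - z.1) + (x.2 - z.2) + (y.2 - z.2).
have [n _ /(_ n (leqnn _))[h v]] := typical_large _ D (tw z).
have corner (u : Z2) : z.1 <= u.1 <= z.1 + hdist (otau z w) n ->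
    z.2 <= u.2 <= z.2 + vdist (otau z w) n ->
    exists k, walk arrow w u k = z + (hdist (otau z w) n, vdist (otau z w) n).
  move=> u1 u2; exists (`|hdist (otau u w) n| + `|vdist (otau u w) n|)%N.
  rewrite walk_corner (otau_sub u z); move: (otau z w) u1 u2 => w' u1 u2.
  rewrite hdist_decr ?vdist_decr /=; [|lia..].
  by apply: injective_projections => /=; lia.
have [||k xk] := corner x; [lia..|].
have [||l yl] := corner y; [lia..|].
by exists k, l; rewrite xk yl.
Qed.

(** * Absence of an asymptotic direction, and the density of the whole lattice *)

Section Direction.
Variable R : realType.

(** The Euclidean norm is at most the l1 norm, hence at most 8 times the coordinate difference. *)
Lemma direction_gap (v : Z2) :
  0 < v.1 - v.2 -> `|v.1| + `|v.2| <= 8 * (v.1 - v.2) ->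
  8^-1 <= (@direction R v).1 - (@direction R v).2.
Proof.
case: v => p q /=; rewrite /direction /= -mulrBl => pq0 pq.
set N := euclidean_norm _.
have le_norm : N <= (`|p| + `|q|)%:~R.
  rewrite /N /euclidean_norm /= -[leRHS]ger0_norm ?ler0z ?addr_ge0 //.
  rewrite -sqrtr_sqr ler_wsqrtr // rmorphD /= !intr_norm sqrrD !real_normK ?num_real //.
  by rewrite lerD2r lerDl mulrn_wge0 // mulr_ge0.
have N0 : 0 < N.
  rewrite sqrtr_gt0 /= lt0r addr_ge0 ?sqr_ge0 // andbT.
  rewrite paddr_eq0 ?sqr_ge0 // !sqrf_eq0 !intr_eq0.
  by apply/negP => /andP[]; lia.
rewrite -rmorphB ler_pdivlMr // mulrC ler_pdivrMr //.
apply: le_trans le_norm _.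
by rewrite mulrC (_ : 8 = (8 : int)%:~R :> R) // -intrM ler_int.
Qed.

Lemma direction_gap_sym (v : Z2) :
  0 < v.2 - v.1 -> `|v.1| + `|v.2| <= 8 * (v.2 - v.1) ->
  8^-1 <= (@direction R v).2 - (@direction R v).1.
Proof.
move=> v0 v8; have := direction_gap (v.2, v.1) v0; rewrite addrC => /(_ v8).
by rewrite /direction /euclidean_norm /= [X in Num.sqrt X]addrC.
Qed.

Lemma no_asymptotic_direction (w : odometer) z : typical (otau z w) ->
  ~ has_asymptotic_direction R (walk arrow w z).
Proof.
move=> tw [u hu].
pose X k := @direction R (walk arrow w z k).
have : (X k).1 - (X k).2 @[k --> \oo] --> u.1 - u.2.
  by apply: cvgB; apply: cvg_comp hu _; [exact: cvg_fst|exact: cvg_snd].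
(* From time [N] on the difference of the direction coordinates stays within 1/8 of its limit, yet
   corners of odd and even levels give values at least 1/8 and at most -1/8. *)
move=> /cvgrPdist_lt /(_ 8^-1); rewrite invr_gt0 ltr0n => /(_ isT)[N _ HN].
(* The first term makes the starting point negligible against the displacement to the corner; the
   second makes the corner be reached after time [N]. *)
pose D : int := 8 * (`|z.1| + `|z.2|) + N%:Z + 1.
have corner b : exists k, (N <= k)%N /\
    if b then 8^-1 <= (X k).1 - (X k).2 else 8^-1 <= (X k).2 - (X k).1.
  have [M _ HM] : \forall n \near \oo,
      (D <= hdist (otau z w) n /\ D <= vdist (otau z w) n) /\
      (odd n = b -> if b then 2 * vdist (otau z w) n <= hdist (otau z w) n
                    else 2 * hdist (otau z w) n <= vdist (otau z w) n).
    by near=> n; split; near: n; [exact: typical_large|exact: typical_ratio].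
  (* The level [b + M.*2] has parity [b] and is at least [M]. *)
  have [|[h v]] := HM (b + M.*2)%N; first by rewrite /=; lia.
  rewrite oddD odd_double addbF oddb => /(_ erefl).
  move: h v; move: (b + _)%N => n h v ratio.
  exists (`|hdist (otau z w) n| + `|vdist (otau z w) n|)%N; split; first by lia.
  rewrite /X walk_corner.
  by case: b {HM} ratio => ratio;
    [apply: direction_gap|apply: direction_gap_sym] => /=; lia.
have [k [/HN /= Hk k8]] := corner true; have [l [/HN /= Hl l8]] := corner false.
move: Hk Hl; rewrite !ltr_norml => /andP[]; lra.
Unshelve. all: by end_near. Qed.

Lemma fset_card_box N : #|` fset_set (setT `&` box N)|%fset = (N.*2.+1 ^ 2)%N.
Proof.
pose s : seq Z2 := [seq (i%:Z - N%:Z, j%:Z - N%:Z)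
                   | i <- iota 0 N.*2.+1, j <- iota 0 N.*2.+1].
have us : uniq s.
  rewrite allpairs_uniq ?iota_uniq // => -[i j] [k l] _ _ /= [ik jl].
  by congr (_, _); lia.
rewrite setTI (_ : box N = [set` [fset x in s]%fset]); last first.
  apply/seteqP; split=> -[x y] /=.
    move=> [/= xN yN]; rewrite in_fset /=; apply/allpairsP.
    exists (`|(x + N%:Z)%R|, `|(y + N%:Z)%R|)%N.
    by rewrite !mem_iota /=; split=> //; [lia|lia|congr (_, _); lia].
  rewrite in_fset /= => /allpairsP[[i j] [i_N j_N [-> ->]]].
  by move: i_N j_N; rewrite !mem_iota => /= *; split=> /=; lia.
rewrite set_fsetK card_fseq undup_id // /s size_allpairs !size_iota; lia.
Qed.

Lemma has_density_setT : has_density [set: Z2] (1 : R).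
Proof.
rewrite /has_density (_ : (fun N : nat => _) = cst 1); first exact: cvg_cst.
by apply/funext => N /=; rewrite fset_card_box divff // pnatr_eq0 expn_eq0.
Qed.

End Direction.

(** * The uniform measure on the odometer *)

Lemma residue_bits (a : nat -> int) n : (forall i, 0 <= a i < 2) ->
  residue a n = \sum_(i < n) a i * 2 ^+ i.
Proof.
move=> bits; apply: modz_small; elim: n => [|n /andP[ge0 lt2]].
  by rewrite big_ord0.
rewrite big_ord_recr /= exprS;
  move: (2 ^+ n) (\sum_(_ < _) _) ge0 lt2 => N S ge0 lt2.
by have [->|->] : a n = 0 \/ a n = 1 by [have := bits n; lia]; lia.
Qed.

Lemma modz_exp2S (c : int) n :
  (c %% 2 ^+ n.+1)%Z = (c %% 2 ^+ n)%Z + ((c %/ 2 ^+ n)%Z %% 2)%Z * 2 ^+ n.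
Proof.
have N0 := expz2_gt0 n.
have r0 : 0 <= (c %% 2 ^+ n)%Z by rewrite modz_ge0 // gt_eqF.
have rN : (c %% 2 ^+ n)%Z < 2 ^+ n by rewrite ltz_pmod.
rewrite {1}(divz_eq c (2 ^+ n)) {1}(divz_eq (c %/ 2 ^+ n)%Z 2) mulrDl -mulrA -exprS.
rewrite -addrA modzMDl modz_small 1?addrC // exprS.
have : 0 <= ((c %/ 2 ^+ n)%Z %% 2)%Z < 2 by lia.
move: (_ %% 2)%Z => b b2; have [->|->] : b = 0 \/ b = 1 by lia.
all: lia.
Qed.

(** Uniqueness of binary expansions: one more level fixes exactly one more bit. *)
Lemma residueS_eq (a : nat -> int) (c : int) n : (forall i, 0 <= a i < 2) ->
  residue a n.+1 = (c %% 2 ^+ n.+1)%Z <->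
  residue a n = (c %% 2 ^+ n)%Z /\ a n = ((c %/ 2 ^+ n)%Z %% 2)%Z.
Proof.
move=> bits; have := residue_ge0 a n; have := residue_lt a n.
rewrite modz_exp2S !residue_bits // big_ord_recr /=; move: (\sum_(_ < _) _) => s.
have N0 := expz2_gt0 n.
have : 0 <= (c %% 2 ^+ n)%Z by rewrite modz_ge0 // gt_eqF.
have : (c %% 2 ^+ n)%Z < 2 ^+ n by rewrite ltz_pmod.
have : 0 <= ((c %/ 2 ^+ n)%Z %% 2)%Z < 2 by lia.
move: ((c %/ 2 ^+ n)%Z %% 2)%Z (c %% 2 ^+ n)%Z (bits n) => b r.
move: (a n) (2 ^+ n) N0 => e N N0 eb bb rN r0 sN s0; split=> [|[-> ->] //].
have [|] : e = 0 \/ e = 1 by lia.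
all: have [|] : b = 0 \/ b = 1 by lia.
all: move=> -> ->; lia.
Qed.

Section Measure.
Variable R : realType.
Implicit Types u : R.

(** The first n base-4 digits of [u] read as one integer; points outside [0, 1) get the default
    0. *)
Definition base4 n u : int :=
  if 0 <= u < 1 then Num.floor (4 ^+ n * u) else 0.

Lemma base4_bound n u : 0 <= base4 n u < 4 ^+ n.
Proof.
rewrite /base4; case: ifP => [/andP[u0 u1]|_]; last by rewrite exprn_gt0.
rewrite floor_ge_int mulr_ge0 ?exprn_ge0 //= floor_lt_int rmorphXn /=.
by rewrite gtr_pMr ?exprn_gt0.
Qed.

Lemma base4S n u : (base4 n.+1 u %/ 4)%Z = base4 n u.
Proof.
rewrite /base4; case: ifP => _ //; set x := 4 ^+ n * u.
rewrite (_ : 4 ^+ n.+1 * u = 4 * x); last by rewrite exprS mulrA.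
have [lo hi] : (Num.floor x)%:~R <= x /\ x < (Num.floor x + 1)%:~R.
  by rewrite floor_le lt_succ_floor.
have : 4 * Num.floor x <= Num.floor (4 * x).
  by rewrite floor_ge_int rmorphM /= ler_pM2l.
have : Num.floor (4 * x) < 4 * (Num.floor x + 1).
  by rewrite floor_lt_int rmorphM /= ltr_pM2l.
lia.
Qed.

(** Each base-4 digit of [u] supplies one binary digit to each coordinate: its low bit to the first,
    its high bit to the second. *)
Definition interleaved_bits u : odometer :=
  (fun i => (base4 i.+1 u %% 2)%Z, fun i => ((base4 i.+1 u %/ 2)%Z %% 2)%Z).

(* Bit reversal: fixing the n low-order binary digits of both coordinates fixes
   the n leading base-4 digits of u. *)
Lemma cylinder_base4 n c : exists k : int, 0 <= k < 4 ^+ n /\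
  forall u, cylinder n c (interleaved_bits u) <-> base4 n u = k.
Proof.
elim: n => [|n [k [kn IH]]].
  exists 0; split=> [//|u]; have := base4_bound 0 u; rewrite /cylinder /=.
  by rewrite /residue !big_ord0 !expr0 !modz1; split=> //; lia.
pose b := ((c.1 %/ 2 ^+ n)%Z %% 2)%Z; pose b' := ((c.2 %/ 2 ^+ n)%Z %% 2)%Z.
(* The appended base-4 digit is b + 2b', with b and b' the next bits of the two coordinates of
   [c]. *)
exists (4 * k + b + 2 * b'); split; first by rewrite exprS /b /b'; lia.
move=> u; have := IH u; rewrite -base4S /cylinder /= => IHu.
rewrite !residueS_eq /=; [|by move=> i; lia..].
rewrite -/b -/b'; have : 0 <= b < 2 by rewrite /b; lia.
have : 0 <= b' < 2 by rewrite /b'; lia.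
move: b b' (base4 _ _) IHu => b b' K IHu b'2 b2; split.
  by move=> [[r1 K1] [r2 K2]]; have : (K %/ 4)%Z = k by [apply/IHu]; lia.
move=> Ek; have /IHu[r1 r2] : (K %/ 4)%Z = k by lia.
by split; split=> //; lia.
Qed.

Definition unit_lebesgue : set (measurableTypeR R) -> \bar R :=
  mrestr (@lebesgue_measure R) (measurable_itv `[0 : R, 1[).

HB.instance Definition _ := Measure.on unit_lebesgue.

Lemma unit_lebesgueT : unit_lebesgue setT = 1%E.
Proof.
by rewrite /unit_lebesgue /mrestr setTI lebesgue_measure_itv /= lte_fin ltr01 oppr0 adde0.
Qed.

HB.instance Definition _ :=
  Measure_isProbability.Build _ _ R unit_lebesgue unit_lebesgueT.

Lemma base4_preimage n k : 0 <= k < 4 ^+ n ->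
  [set u | base4 n u = k] `&` `[0 : R, 1[ =
  `[k%:~R / 4 ^+ n, (k + 1)%:~R / 4 ^+ n[%classic.
Proof.
move=> /andP[k0 k4]; have N0 : 0 < 4 ^+ n :> R by rewrite exprn_gt0.
apply/seteqP; split=> u /=;
  rewrite !in_itv /= ler_pdivrMr // ltr_pdivlMr // mulrC.
  move=> [+ u01]; rewrite /base4 u01 => <-.
  by rewrite floor_le lt_succ_floor.
move=> /andP[ku uk].
have u01 : 0 <= u < 1.
  rewrite -(pmulr_rge0 _ N0) (le_trans _ ku) ?ler0z // -(ltr_pM2l N0) mulr1.
  apply: lt_le_trans uk _;
    have -> : 4 ^+ n = (4 ^+ n : int)%:~R :> R by rewrite rmorphXn.
  by rewrite ler_int; lia.
by split=> //; rewrite /base4 u01; apply: floor_def; rewrite ku uk.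
Qed.

Lemma unit_lebesgue_base4 n k : 0 <= k < 4 ^+ n ->
  unit_lebesgue [set u | base4 n u = k] = (4 ^- n)%:E.
Proof.
move=> kn; rewrite /unit_lebesgue /mrestr base4_preimage //.
rewrite lebesgue_measure_itv /= lte_fin.
rewrite ltr_pM2r ?invr_gt0 ?exprn_gt0 // ltr_int ltzD1 lexx -EFinD.
by rewrite -mulrBl -rmorphB /= addrC addKr mul1r.
Qed.

Lemma measurable_base4 n k :
  measurable ([set u | base4 n u = k] : set (measurableTypeR R)).
Proof.
have [kn|/negP kn] := boolP (0 <= k < 4 ^+ n); last first.
  rewrite (_ : [set _ | _] = set0) //; apply/seteqP; split=> u //= uk.
  by case: kn; rewrite -uk base4_bound.
rewrite -(setUIDK [set u | base4 n u = k] `[0 : R, 1[) base4_preimage //.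
apply: measurableU; first exact: measurable_itv.
(* Outside [0, 1) only the default value 0 occurs: the remaining part is the whole complement if k =
   0, and empty otherwise. *)
have [->|k0] := eqVneq k 0.
  rewrite (_ : _ `\` _ = ~` `[0 : R, 1[) ?setDE; first exact: measurableC.
  rewrite setIidr // => u /= /negP/negbTE; rewrite in_itv /= => u01.
  by rewrite /base4 u01.
rewrite (_ : _ `\` _ = set0); first exact: measurable0.
rewrite setDE; apply/seteqP; split=> u //= [+ /negP/negbTE];
  rewrite in_itv /= /base4 => + u01.
by rewrite u01 => /esym/eqP; rewrite (negbTE k0).
Qed.

Lemma interleaved_bits_cylinder n c : exists2 k : int, 0 <= k < 4 ^+ n &
  interleaved_bits @^-1` cylinder n c = [set u | base4 n u = k].
Proof.
have [k [kn H]] := cylinder_base4 n c.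
by exists k => //; apply/seteqP; split=> u /H.
Qed.

Lemma measurable_interleaved_bits :
  measurable_fun [set: measurableTypeR R]
    (interleaved_bits : measurableTypeR R -> odometer).
Proof.
apply: (@measurability _ _ _ odometer _ _ odo_cylinders) => //.
move=> _ [_ [->|[n [c ->]]] <-]; rewrite setTI.
  by rewrite preimage_set0; exact: measurable0.
by have [k _ ->] := interleaved_bits_cylinder n c; exact: measurable_base4.
Qed.

HB.instance Definition _ := isMeasurableFun.Build _ _ _ _
  (interleaved_bits : measurableTypeR R -> odometer) measurable_interleaved_bits.

(** On residues this is the Haar measure of pairs of 2-adic integers, obtained as an image of
    Lebesgue measure on [0, 1). *)
Definition odo_prob : probability odometer R :=
  distribution unit_lebesgue (interleaved_bits : measurableTypeR R -> odometer).

Lemma odo_prob_cylinder n c : odo_prob (cylinder n c) = (4 ^- n)%:E.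
Proof.
rewrite /odo_prob /distribution /pushforward /=.
by have [k kn ->] := interleaved_bits_cylinder n c; exact: unit_lebesgue_base4.
Qed.

End Measure.

(** * Cylinders and their translates *)

Lemma measurable_cylinder n c : measurable (cylinder n c : set odometer).
Proof. by apply: sub_sigma_algebra; right; exists n, c. Qed.

Lemma cylinder0 c : cylinder 0 c = setT.
Proof. by apply/seteqP; split=> w // _;
  rewrite /cylinder /= /residue !expr0 !modz1. Qed.

(** Two cylinders are either nested or disjoint. *)
Lemma odo_cylindersI : setI_closed odo_cylinders.
Proof.
move=> _ _ [->|[m [c ->]]] [->|[n [e ->]]]; rewrite ?set0I ?setI0; do ?by left.
wlog mn : m n c e / (m <= n)%N.
  by have [mn|/ltnW nm] := leqP m n; [|rewrite setIC]; apply.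
have [[eqm1 eqm2]|neqm] := pselect ((c.1 %% 2 ^+ m)%Z = (e.1 %% 2 ^+ m)%Z /\
                            (c.2 %% 2 ^+ m)%Z = (e.2 %% 2 ^+ m)%Z).
  right; exists n, e; apply: setIidr => w [w1 w2]; rewrite /cylinder /=.
  by rewrite -!(residue_mod _ _ _ mn) w1 w2 !modz_exp2 // eqm1 eqm2.
left; apply/seteqP; split=> w // [[c1 c2] [w1 w2]]; apply: neqm.
by rewrite -c1 -c2 -!(residue_mod _ _ _ mn) w1 w2 !modz_exp2.
Qed.

Lemma otau_cylinder z n c : otau z @^-1` cylinder n c = cylinder n (c + z).
Proof.
have key a (x y : int) :
    residue (decr x a) n = (y %% 2 ^+ n)%Z <-> residue a n = ((y + x) %% 2 ^+ n)%Z.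
  rewrite residue_decr; split=> /eqP.
    rewrite -(eqz_modDr x) subrK /residue modz_mod => /eqP //.
  by rewrite /residue -[X in X == _]modz_mod -(eqz_modDr (- x)) addrK => /eqP.
by apply/seteqP; split=> w [/key w1 /key w2]; split.
Qed.

Lemma measurable_otau z : measurable_fun [set: odometer] (otau z).
Proof.
apply: (@measurability _ _ _ odometer _ _ odo_cylinders) => //.
move=> _ [_ [->|[n [c ->]]] <-]; rewrite setTI.
  by rewrite preimage_set0; exact: measurable0.
by rewrite otau_cylinder; exact: measurable_cylinder.
Qed.


HB.instance Definition _ z := isMeasurableFun.Build _ _ _ _
  (otau z : odometer -> odometer) (measurable_otau z).

(** * Invariance and ergodicity *)

Section Ergodicity.
Variables (R : realType) (P : probability odometer R).
Hypothesis P_cylinder : forall n c, P (cylinder n c) = (4 ^- n)%:E.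

Lemma odo_measure_eq (m1 m2 : {measure set odometer -> \bar R}) :
  (m1 setT < +oo)%E -> (forall n c, m1 (cylinder n c) = m2 (cylinder n c)) ->
  forall A, measurable A -> m1 A = m2 A.
Proof.
move=> m1oo m12 A mA.
apply: (@measure_unique _ R odometer odo_cylinders (fun=> setT)) => //;
  first exact: odo_cylindersI.
- by move=> _; right; exists 0%N, 0; rewrite cylinder0.
- by rewrite bigcup_const //; exists 0%N.
- by move=> _ [->|[n [c ->]]]; rewrite ?measure0.
Qed.

(** Translations permute the cylinders of a given level, which all have the same mass, and cylinders
    determine the measure. *)
Lemma otau_measure_preserving : measure_preserving P otau.
Proof.
move=> z; split=> [|A mA]; first exact: measurable_otau.
apply: (@odo_measure_eq (distribution P (otau z)) P) => //.
  by rewrite -[X in (X < _)%E]/(P setT) probability_setT ltry.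
move=> n c; rewrite -[LHS]/(P (otau z @^-1` cylinder n c)) otau_cylinder P_cylinder.
exact/esym/P_cylinder.
Qed.

Lemma equidistributed_cylinder (m : {measure set odometer -> \bar R}) n c :
  (forall e, m (cylinder n e) = m (cylinder n c)) ->
  m setT = ((4 ^ n)%:R%:E * m (cylinder n c))%E.
Proof.
(* The space is the disjoint union of the 4^n cylinders of level n; their residue pairs are
   enumerated as quotient and remainder of [k] by 2^n. *)
move=> mE; pose F k := cylinder n ((k %/ 2 ^ n)%N%:Z, (k %% 2 ^ n)%N%:Z).
have N0 : (0 < 2 ^ n)%N by rewrite expn_gt0.
have modN (i : nat) : (i < 2 ^ n)%N -> (i%:Z %% 2 ^+ n)%Z = i%:Z.
  by move=> iN; rewrite modz_small // expz2E ltz_nat.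
have FE k w : (k < 2 ^ n * 2 ^ n)%N ->
    F k w <-> residue w.1 n = (k %/ 2 ^ n)%N /\ residue w.2 n = (k %% 2 ^ n)%N.
  by move=> kN; rewrite /F /cylinder /= !modN ?ltn_pmod // ltn_divLR.
have -> : [set: odometer] = \bigcup_(k in `I_(2 ^ n * 2 ^ n)) F k.
  apply/seteqP; split=> // w _.
  have := residue_ge0 w.1 n; have := residue_lt w.1 n.
  have := residue_ge0 w.2 n; have := residue_lt w.2 n; rewrite expz2E.
  case Ej : (residue w.2 n) => [j|//] jN _;
    case Ei : (residue w.1 n) => [i|//] iN _.
  have kN : (i * 2 ^ n + j < 2 ^ n * 2 ^ n)%N by nia.
  exists (i * 2 ^ n + j)%N => //; apply/FE => //.
  by rewrite Ei Ej divnMDl // modnMDl divn_small ?modn_small // addn0.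
rewrite measure_fin_bigcup //; last by move=> k _; exact: measurable_cylinder.
  rewrite -fsbig_ord (eq_bigr (fun=> m (cylinder n c))) => [|k _]; last exact: mE.
  rewrite big_const_ord -expnMn mule_natl.
  by elim: (_ ^ n)%N => // k IH; rewrite iterS IH muleS.
move=> k l kN lN [w [/FE -/(_ kN)[k1 k2] /FE -/(_ lN)[l1 l2]]].
rewrite (divn_eq k (2 ^ n)) (divn_eq l (2 ^ n)); congr (_ * _ + _)%N; lia.
Qed.

(* By invariance A meets all cylinders of a given level in equal mass, hence is
   independent of every cylinder, hence of itself. *)
Lemma otau_ergodic : ergodic P otau.
Proof.
move=> A mA invA.
have PA0 : 0 <= fine (P A) by exact: fine_ge0.
have PAE : P A = (fine (P A))%:E by rewrite fineK // fin_num_measure.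
have cylA n c : P (cylinder n c `&` A) = ((fine (P A))%:E * P (cylinder n c))%E.
  have : P (setT `&` A) = ((4 ^ n)%:R%:E * P (cylinder n c `&` A))%E.
    apply: (@equidistributed_cylinder (mrestr P mA)) => e.
    (* Pulling back by [c - e] turns the cylinder of [e] into that of [c] and leaves [A]
       unchanged. *)
    rewrite -[LHS](otau_measure_preserving (c - e)).2; last first.
      by apply: measurableI => //; exact: measurable_cylinder.
    by rewrite preimage_setI otau_cylinder invA subrKC.
  rewrite setTI P_cylinder => ->.
  have : P (cylinder n c `&` A) \is a fin_num.
    by rewrite fin_num_measure //; apply: measurableI => //;
      exact: measurable_cylinder.
  move=> /fineK <-; rewrite -!EFinM /= natrX mulrAC mulfV ?mul1r // expf_neq0 //.
(* The mass within [A] and the multiple of [P] by the mass of [A] agree on cylinders, hence on [A]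
   itself: the mass of [A] equals its square. *)
have : P (A `&` A) = ((fine (P A))%:E * P A)%E.
  apply: (@odo_measure_eq (mrestr P mA) (mscale (NngNum PA0) P)) => //.
  by rewrite -[X in (X < _)%E]/(P (setT `&` A)) setTI PAE ltry.
rewrite setIid PAE -EFinM => -[/eqP].
rewrite -subr_eq0 -{1}[fine _]mulr1 -mulrBr mulf_eq0 subr_eq0.
by move=> /orP[/eqP ->|/eqP <-]; [left|right].
Qed.

End Ergodicity.

(** * Almost sure behaviour *)

(** The event depends only on the residues at level max(m, n), so it is a countable union of
    cylinders. *)
Lemma measurable_residues m n (Q : int -> int -> Prop) :
  measurable ([set w | Q (residue w.1 m) (residue w.2 n)] : set odometer).
Proof.
pose N := maxn m n.
pose F (c : Z2) : set odometer :=
  if `[< Q (c.1 %% 2 ^+ m)%Z (c.2 %% 2 ^+ n)%Z >] then cylinder N c else set0.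
rewrite (_ : mkset _ = \bigcup_c F c).
  apply: countable_bigcupT_measurable => [|c]; first exact: countableP.
  by rewrite /F; case: ifP => _; [exact: measurable_cylinder|exact: measurable0].
have mN : (m <= N)%N by rewrite leq_maxl.
have nN : (n <= N)%N by rewrite leq_maxr.
apply/seteqP; split=> w /=.
  move=> Qw; exists (residue w.1 N, residue w.2 N) => //.
  rewrite /F /= !residue_mod // asboolT // /cylinder /=.
  by rewrite !residue_mod.
move=> [c _]; rewrite /F; case: asboolP => // Qc [/= w1 w2].
by rewrite -(residue_mod _ _ _ mN) -(residue_mod _ _ _ nN) w1 w2 !modz_exp2.
Qed.

Lemma measurable_arrow0 : measurable_fun [set: odometer] arrow0.
Proof.
apply: (measurable_fun_bool true); rewrite setTI.
rewrite (_ : _ @^-1` _ = \bigcap_n [set w | vdist w n = 0 -> hdist w n = 0]).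
  by apply: bigcapT_measurable => n;
    exact: measurable_residues (fun h v => v = 0 -> h = 0).
apply/seteqP; split=> w /=; first by move=> /asboolP + n _; apply.
by move=> H; apply/asboolP => n; exact: H.
Qed.

Lemma measurable_arrow : measurable_fun [set: odometer * Z2] arrow.
Proof.
move=> _ B _; rewrite setTI.
rewrite (_ : _ @^-1` _ = \bigcup_z
  (((arrow0 \o otau z) @^-1` B) `*` ([set z.1] `*` [set z.2]))).
  apply: countable_bigcupT_measurable => [|z]; first exact: countableP.
  apply: measurableX; last exact: measurableX.
  rewrite -[X in measurable X]setTI.
  exact: (measurableT_comp measurable_arrow0 (measurable_otau z)).
apply/seteqP; split=> [[w [x y]] /= Bw|[w [x y]] [z _] [/= Bw [-> ->]]];
  first by exists (x, y).
by case: z Bw.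
Qed.

(** * Borel-Cantelli estimates for typical odometers *)

Section Typical.
Variables (R : realType) (P : probability odometer R).
Hypothesis P_cylinder : forall n c, P (cylinder n c) = (4 ^- n)%:E.
Hypothesis P_otau : measure_preserving P otau.

Lemma prob_le_cover (A : set odometer) m N (F : nat -> Z2) : measurable A ->
  A `<=` \bigcup_(k < N) cylinder m (F k) -> (P A <= (N%:R / 4 ^+ m)%:E)%E.
Proof.
move=> mA; rewrite bigcup_mkord => AF.
have mF k : measurable (cylinder m (F k) : set odometer) by exact: measurable_cylinder.
apply: (@le_trans _ _ (P (\big[setU/set0]_(k < N) cylinder m (F k)))).
  by apply: le_measure => //; apply: mem_set => //; exact: bigsetU_measurable.
apply: (le_trans
  (@Boole_inequality _ _ _ P (fun k => cylinder m (F k)) N (fun k _ => mF k))).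
rewrite (eq_bigr (fun=> (4 ^- m)%:E)) => [|k _]; last exact: P_cylinder.
by rewrite sumEFin sumr_const card_ord mulr_natl.
Qed.

(** One residue has 2^(m-n) admissible values and the other 2^m, so that many cylinders of mass 4^-m
    cover the event. *)
Lemma prob_residue_small (b : bool) m n : (n <= m)%N ->
  (P [set w : odometer | (residue (if b then w.1 else w.2) m * 2 ^+ n < 2 ^+ m)%R] <=
   (2 ^- n)%:E)%E.
Proof.
move=> nm.
have <- : (2 ^ (m - n) * 2 ^ m)%:R / 4 ^+ m = 2 ^- n :> R.
  rewrite -natrX -[4%N]/(2 * 2)%N expnMn !natrM invfM mulrA mulfK ?natrX ?expf_neq0 //.
  by rewrite -{2}(subnK nm) exprD invfM mulVKf // expf_neq0.
(* The quotient by 2^m runs over the small residue, the remainder over the free one. *)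
pose F k : Z2 := let i := (k %/ 2 ^ m)%N%:Z in let j := (k %% 2 ^ m)%N%:Z in
  if b then (i, j) else (j, i).
apply: (prob_le_cover _ m _ F).
  by case: b {F}; [exact: measurable_residues m 0 (fun h _ => h * 2 ^+ n < 2 ^+ m)
                  |exact: measurable_residues 0 m (fun _ v => v * 2 ^+ n < 2 ^+ m)].
move=> w /=;
  rewrite -[X in _ < 2 ^+ X](subnK nm) exprD ltr_pM2r ?expz2_gt0 // !expz2E => small.
have := residue_ge0 w.1 m; have := residue_lt w.1 m.
have := residue_ge0 w.2 m; have := residue_lt w.2 m; rewrite expz2E.
move: small; case Ej : (residue w.2 m) => [j|];
  case Ei : (residue w.1 m) => [i|] //.
pose k := (if b then i * 2 ^ m + j else j * 2 ^ m + i)%N.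
move=> small jN _ iN _; exists k; first by rewrite /k /=;
  case: b {F k} small => /=; nia.
rewrite /cylinder /= /F /k Ei Ej expz2E.
case: b {F k} small => small.
  by rewrite divnMDl ?expn_gt0 // modnMDl divn_small // modn_small // addn0 !modz_small.
by rewrite divnMDl ?expn_gt0 // modnMDl divn_small // modn_small // addn0 !modz_small.
Qed.

Definition atypical n : set odometer :=
  [set w | hdist w n * 2 ^+ n < 2 ^+ scale true n] `|`
  [set w | vdist w n * 2 ^+ n < 2 ^+ scale false n].

Lemma measurable_hsmall n :
  measurable ([set w | hdist w n * 2 ^+ n < 2 ^+ scale true n] : set odometer).
Proof.
exact: (measurable_residues (scale true n) 0
  (fun h _ => h * 2 ^+ n < 2 ^+ scale true n)).
Qed.

Lemma measurable_vsmall n :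
  measurable ([set w | vdist w n * 2 ^+ n < 2 ^+ scale false n] : set odometer).
Proof.
exact: (measurable_residues 0 (scale false n)
  (fun _ v => v * 2 ^+ n < 2 ^+ scale false n)).
Qed.

Lemma measurable_atypical n : measurable (atypical n).
Proof. by apply: measurableU;
  [exact: measurable_hsmall|exact: measurable_vsmall]. Qed.

Lemma prob_atypical n : (3 < n)%N -> (P (atypical n) <= (2 ^- n + 2 ^- n)%:E)%E.
Proof.
move=> n3; have nm b : (n <= scale b n)%N by have := scale_ge b n n3; lia.
apply: (le_trans (measureU2 _ _ _)).
- exact: measurable_hsmall.
- exact: measurable_vsmall.
by rewrite EFinD leeD //; [exact: (prob_residue_small true) (nm true)
                         |exact: (prob_residue_small false) (nm false)].
Qed.

Lemma ae_typical : {ae P, forall w, typical w}.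
Proof.
(* The shift by 4 puts every index in the range of [prob_atypical]; the bound 2 * 2^-(n+4) is then
   below the summable 2^-(n+1). *)
have mF n : measurable (atypical (n + 4)%N) by exact: measurable_atypical.
exists (lim_sup_set (fun n => atypical (n + 4)%N)); split.
- by apply: bigcap_measurable => // k _; exact: bigcup_measurable.
- apply: lim_sup_set_cvg0 => //.
  apply: (@le_lt_trans _ _ (\sum_(n <oo) (1 / (2 ^ (n + 1))%:R)%:E)%E).
    apply: lee_nneseries => // n _; apply: le_trans (prob_atypical _ _) _;
      first lia.
    rewrite lee_fin natrX !exprD !invfM;
      have : 0 < 2 ^- n :> R by rewrite invr_gt0 exprn_gt0.
    lra.
  by rewrite (cvg_lim _ (@cvg_geometric_eseries_half R 1 0)) // ltry.
- move=> w /= ntyp n _; apply: contrapT => typ; apply: ntyp.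
  exists (n + 4)%N => // k /= nk.
  have : ~ atypical k w.
    by move=> ak; apply: typ; exists (k - 4)%N; rewrite /= ?subnK //; lia.
  by move=> /not_orP[/negP + /negP]; rewrite -!leNgt.
Qed.

Lemma ae_typical_otau : {ae P, forall w, forall z, typical (otau z w)}.
Proof.
(* A countable intersection over [Z2], indexed by codes in [nat]; codes of no point impose
   nothing. *)
suff H : {ae P, forall w, forall n,
    if (unpickle n : option Z2) is Some z then typical (otau z w) else True}.
  by apply: filterS H => w H z; have := H (pickle z); rewrite pickleK.
apply: ae_foralln => n; case: (unpickle n : option Z2) => [z|]; last exact: aeW.
have [A [mA PA0 sA]] := ae_typical.
have [mz Pz] := P_otau z.
exists (otau z @^-1` A); split; last by move=> w /= ntyp; exact: sA.
- by rewrite -[X in measurable X]setTI; exact: mz.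
- exact: etrans (Pz A mA) PA0.
Qed.

End Typical.

(** * Stationarity of the weight field *)

Lemma measurable_weight_field {R : realType} {d} {Omega : measurableType d}
    (W : Omega -> Z2 -> step -> R) :
  (forall x z, measurable_fun [set: Omega] (fun w => W w x z : measurableTypeR R)) ->
  forall A, <<s cylinders >> A -> measurable [set w | A (W w)].
Proof.
move=> mW; apply: (@smallest_sub _ _ _ [set A | measurable [set w | A (W w)]]);
  last first.
  move=> _ [x [z [B [mB ->]]]] /=.
  by have := mW x z measurableT B mB; rewrite setTI.
split=> [|A mA|F mF] /=; first exact: measurable0.
- rewrite (_ : mkset _ = ~` [set w | A (W w)]); first exact: measurableC.
  by apply/seteqP; split=> w /= => [[]//|]; split.
- rewrite (_ : mkset _ = \bigcup_n [set w | F n (W w)]);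
  first exact: bigcupT_measurable.
  by apply/seteqP; split=> w /= [n _ Fn]; exists n.
Qed.

(** Shifting the weights by y gives the weight field of the configuration [tau y w], so invariance
    of [P] carries over to the law of the field. *)
Lemma arrow_weights_stationary {R : realType} {d} {Omega : measurableType d}
    (P : probability Omega R) (tau : Z2 -> Omega -> Omega)
    (alpha : Omega * Z2 -> step) :
  Z2_action tau -> measure_preserving P tau ->
  measurable_fun [set: Omega] (fun w => alpha (w, 0)) ->
  stationary_fpp P (arrow_weights tau alpha : Omega -> Z2 -> step -> R).
Proof.
move=> [_ tauD] tauP malpha.
have mW x z : measurable_fun [set: Omega]
    (fun w => arrow_weights tau alpha w x z : measurableTypeR R).
  pose f (b : bool) : measurableTypeR R := if b == z then 2^-1 else 1.
  have mf : measurable_fun setT f by move=> _ B _.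
  exact: (measurableT_comp mf (measurableT_comp malpha (tauP x).1)).
split=> // [w x z|y A mA].
  by rewrite /arrow_weights /step_weight; case: ifP.
rewrite -[RHS](tauP y).2; last exact: measurable_weight_field.
congr (P _); apply/seteqP; split=> w /=;
  by congr (A _); apply/funext => x; apply/funext => z;
    rewrite /shift_weights /arrow_weights tauD.
Qed.

Theorem corollary2p17 (R : realType) :
  exists (d : measure_display) (Omega : measurableType d)
    (P : probability Omega R) (tau : Z2 -> Omega -> Omega)
    (alpha : Omega * Z2 -> step),
    [/\ ergodic_mp_system P tau,
        measurable_fun [set: Omega * Z2] alpha,
        stationary_arrows P tau alpha,
        {ae P, forall omega, forall x y,
          coalesce (walk alpha omega x) (walk alpha omega y)} &
        {ae P, forall omega, forall z,
          ~ has_asymptotic_direction R (walk alpha omega z)}] /\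
    let W : Omega -> Z2 -> step -> R := arrow_weights tau alpha in
    [/\ stationary_fpp P W,
        {ae P, forall omega,
          [/\ forall z, geodesic (W omega) (walk alpha omega z),
              compatible (walk alpha omega) &
              forall x y,
                coalesce (walk alpha omega x) (walk alpha omega y)]} &
        {ae P, forall omega, exists2 c : R, 0 < c &
          has_density [set z | geodesic (W omega) (walk alpha omega z) /\
            ~ has_asymptotic_direction R (walk alpha omega z)] c}].
Proof.
pose P := odo_prob R.
have P_cyl := @odo_prob_cylinder R.
have tauP := otau_measure_preserving _ P P_cyl.
have tau_act : Z2_action otau by split; [exact: otau0|exact: otauD].
have arrow_tau w z : arrow (w, z) = arrow (otau z w, 0) by rewrite /arrow /= otau0.
have typ := ae_typical_otau _ P P_cyl tauP.
have coal : {ae P, forall w, forall x y, coalesce (walk arrow w x) (walk arrow w y)}.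
  by apply: filterS typ => w; exact: coalesce_walks.
have nodir : {ae P, forall w, forall z, ~ has_asymptotic_direction R (walk arrow w z)}.
  by apply: filterS typ => w tw z; exact: no_asymptotic_direction.
have geo w z : geodesic (arrow_weights otau arrow w : Z2 -> step -> R) (walk arrow w z).
  exact: geodesic_walk.
exists _, odometer, P, otau, arrow; split; split=> //.
- by split=> //; exact: (otau_ergodic _ P).
- exact: measurable_arrow.
- by apply: aeW => w.
- apply: arrow_weights_stationary => //.
  rewrite (_ : (fun w => _) = arrow0); first exact: measurable_arrow0.
  by apply/funext => w; rewrite /arrow /= otau0.
- by apply: filterS coal => w coal_w; split=> //; exact: compatible_walk.
(* Almost surely every lattice point qualifies, so the density is 1. *)
- apply: filterS nodir => w nodir_w; exists 1 => //.
  rewrite (_ : mkset _ = setT); first exact: has_density_setT.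
  by apply/seteqP; split=> z //= _; split.
Qed.
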